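(* Let $\mathcal{S}(132)$ denote the set of all permutations of all lengths $n\ge 0$ (including the empty permutation) that avoid the classical pattern $1\text{-}3\text{-}2$. For a permutation $\pi=\pi_1\cdots\pi_n$ define $f_1(\pi)=n$, $f_2(\pi)=\#\{i:\pi_i>\pi_{i+1}\}$ (the number of occurrences of the generalized pattern $21$, i.e. adjacent descents), and for $k\ge 3$ let $f_k(\pi)$ be the number of occurrences of the generalized pattern $21\text{-}3\text{-}\cdots\text{-}k$, i.e. the number of index tuples $(i,j_3,\dots,j_k)$ with $i+1<j_3<j_4<\cdots<j_k$ and $\pi_{i+1}<\pi_i<\pi_{j_3}<\cdots<\pi_{j_k}$. For $n\ge 0$ put $P_n=\prod_{k=0}^{n} x_{k+2}^{\binom{n}{k}}$, where $x_1,x_2,\dots$ are indeterminates. Then $$\sum_{\pi\in\mathcal{S}(132)}\prod_{k\ge1}x_k^{f_k(\pi)}=1-\cfrac{x_1}{x_1P_0-\cfrac{1}{1-\cfrac{x_1}{x_1P_1-\cfrac{1}{1-\cfrac{x_1}{x_1P_2-\cfrac{1}{\ddots}}}}}}.$$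
   Context: Identity of formal power series in the indeterminates $x_1,x_2,\dots$; a permutation avoids $1\text{-}3\text{-}2$ if it has no indices $a<b<c$ with $\pi_a<\pi_c<\pi_b$. *)

(* Defs.v *)
From HB Require Import structures.
From mathcomp Require Import all_boot all_order all_fingroup all_algebra.
From mathcomp Require Import finmap boolp monalg.

Set Implicit Arguments.
Unset Strict Implicit.
Unset Printing Implicit Defensive.

Import GRing.Theory.

Local Open Scope fset_scope.
Local Open Scope ring_scope.

(* Formal power series in commuting indeterminates indexed by the possibly
   infinite type [I]; a monomial of [{cmonom I}] has finite support. *)

Record fps (I : choiceType) (R : Type) := FPS { fcoef : {cmonom I} -> R }.

Section SubMonomials.
Variable I : choiceType.
Implicit Type m : {cmonom I}.

Definition bounded_monomial m (g : {ffun finsupp m -> 'I_(mdeg m).+1}) :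
  {cmonom I} := mkcmonom [fsfun i : finsupp m => nat_of_ord (g i) | 0%N].

(* contains every divisor of [m], see [mem_sub_monomials] *)
Definition sub_monomials m : {fset {cmonom I}} :=
  [fset bounded_monomial g | g : {ffun finsupp m -> 'I_(mdeg m).+1}].

End SubMonomials.

(* all pairs of monomials with product [m], see [mem_factors] *)
HB.lock Definition factors (I : choiceType) (m : {cmonom I}) :
    {fset {cmonom I} * {cmonom I}} :=
  [fset p in sub_monomials m `*` sub_monomials m | mmul p.1 p.2 == m].

Section Factors.
Variable I : choiceType.
Implicit Types a b c d m : {cmonom I}.

Lemma cm_le_mdeg m i : (m i <= mdeg m)%N.
Proof.
case: (boolP (i \in finsupp m)) => [im|]; last by rewrite -cmE_eq0 => /eqP->.
by rewrite mdegE (big_fsetD1 i im) leq_addr.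
Qed.

Lemma mem_sub_monomials a b : a \in sub_monomials (mmul a b).
Proof.
set m := mmul a b.
have le i : (a i <= m i)%N by rewrite cmM leq_addr.
apply/imfsetP.
exists [ffun i : finsupp m => inord (a (val i)) : 'I_(mdeg m).+1] => //.
apply/eqP/cmP => i; rewrite cmE /= fsfun_ffun.
case: insubP => [j _ ji|]; last first.
  by rewrite -cmE_eq0 -leqn0 => /(leq_trans (le i)); rewrite leqn0 => /eqP.
by rewrite /= ffunE -ji inordK // ltnS (leq_trans (le _)) ?cm_le_mdeg.
Qed.

Lemma mem_factors m p : (p \in factors m) = (mmul p.1 p.2 == m).
Proof.
case: p => a b; rewrite unlock !inE /=; apply: andb_idl => /eqP <-.
by rewrite mem_sub_monomials mulmC mem_sub_monomials.
Qed.

End Factors.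

Section FPSRing.
Variables (I : choiceType) (R : comNzRingType).
Implicit Types (f g h : fps I R) (a b c d m : {cmonom I}).

HB.instance Definition _ := gen_eqMixin (fps I R).
HB.instance Definition _ := gen_choiceMixin (fps I R).

Lemma fpsP f g : (forall m, fcoef f m = fcoef g m) <-> f = g.
Proof. by split=> [|-> //]; case: f g => f [g] /= /funext ->. Qed.

Definition fps_zero : fps I R := FPS (fun=> 0).
Definition fps_one : fps I R := FPS (fun m => (m == mone)%:R).
Definition fps_opp f := FPS (fun m => - fcoef f m).
Definition fps_add f g := FPS (fun m => fcoef f m + fcoef g m).
Definition fps_mul f g :=
  FPS (fun m => \sum_(p <- factors m) fcoef f p.1 * fcoef g p.2).

Lemma fps_addA : associative fps_add.
Proof. by move=> f g h; apply/fpsP => m /=; rewrite addrA. Qed.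
Lemma fps_addC : commutative fps_add.
Proof. by move=> f g; apply/fpsP => m /=; rewrite addrC. Qed.
Lemma fps_add0 : left_id fps_zero fps_add.
Proof. by move=> f; apply/fpsP => m /=; rewrite add0r. Qed.
Lemma fps_addN : left_inverse fps_zero fps_opp fps_add.
Proof. by move=> f; apply/fpsP => m /=; rewrite addNr. Qed.

HB.instance Definition _ := GRing.isZmodule.Build (fps I R)
  fps_addA fps_addC fps_add0 fps_addN.

(* The Cauchy product may be computed on any finite set of monomials
   containing the divisors of [m]. *)
Lemma fps_mulE (D : {fset {cmonom I}}) f g m :
    (forall a b, mmul a b = m -> a \in D) ->
  fcoef (fps_mul f g) m =
  \sum_(a <- D) \sum_(b <- D) (mmul a b == m)%:R * (fcoef f a * fcoef g b).
Proof.
move=> hD; rewrite pair_big_dep_cond /fps_mul /=.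
transitivity (\sum_(p <- factors m)
    (mmul p.1 p.2 == m)%:R * (fcoef f p.1 * fcoef g p.2)).
  by apply: eq_fbigr => p; rewrite mem_factors => ->; rewrite mul1r.
apply: big_fset_incl => [|p _]; last first.
  by rewrite mem_factors => /negbTE ->; rewrite mul0r.
apply/fsubsetP => -[a b]; rewrite mem_factors => /eqP /= ab.
apply/imfset2P; exists a; first by rewrite !inE (hD _ _ ab).
by exists b => //; rewrite !inE (hD b a) // mulmC.
Qed.

Lemma fps_mulC : commutative fps_mul.
Proof.
move=> f g; apply/fpsP => m.
have hD a b : mmul a b = m -> a \in sub_monomials m.
  by move=> <-; apply: mem_sub_monomials.
rewrite !(fps_mulE _ _ hD) exchange_big /=; apply: eq_bigr => b _.
by apply: eq_bigr => a _; rewrite mulmC [fcoef f _ * _]mulrC.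
Qed.

Lemma fps_mul3E (D : {fset {cmonom I}}) f g h m :
    (forall a b, mmul a b = m -> a \in D) ->
  fcoef (fps_mul (fps_mul f g) h) m =
  \sum_(a <- D) \sum_(b <- D) \sum_(c <- D)
    (mmul (mmul a b) c == m)%:R * (fcoef f a * fcoef g b * fcoef h c).
Proof.
move=> hD; rewrite (fps_mulE _ _ hD).
transitivity (\sum_(c <- D) \sum_(d <- D) \sum_(a <- D) \sum_(b <- D)
   (mmul a b == d)%:R * ((mmul d c == m)%:R *
                         (fcoef f a * fcoef g b * fcoef h c))).
  rewrite exchange_big /=; apply: eq_bigr => c _; apply: eq_bigr => d _.
  have [dcm|ndcm] := eqVneq (mmul d c) m; last first.
    by rewrite mul0r big1 // => a _; rewrite big1 // => b _; rewrite mul0r mulr0.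
  rewrite mul1r -[\sum_(p <- factors d) _]/(fcoef (fps_mul f g) d) (@fps_mulE D); last first.
    by move=> a b abd; apply: (hD a (mmul b c)); rewrite mulmA abd.
  rewrite mulr_suml; apply: eq_bigr => a _; rewrite mulr_suml.
  by apply: eq_bigr => b _; rewrite mul1r !mulrA.
transitivity (\sum_(c <- D) \sum_(a <- D) \sum_(b <- D) \sum_(d <- D)
   (mmul a b == d)%:R * ((mmul d c == m)%:R *
                         (fcoef f a * fcoef g b * fcoef h c))).
  apply: eq_bigr => c _; rewrite exchange_big; apply: eq_bigr => a _.
  exact: exchange_big.
rewrite exchange_big /=; apply: eq_bigr => a _.
rewrite exchange_big /=; apply: eq_bigr => b _; apply: eq_bigr => c _.
have [abD|abND] := boolP (mmul a b \in D).
  rewrite (big_fsetD1 (mmul a b) abD) /=.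
  rewrite [mmul a b == mmul a b]eqxx mul1r
    big_seq big1 ?addr0 // => d.
  by rewrite in_fsetD1 eq_sym => /andP[/negbTE -> _]; rewrite mul0r.
rewrite big_seq big1 => [|d dD]; last first.
  by case: eqP abND => [->|]; rewrite ?dD // mul0r.
by case: eqP => [abc|_]; rewrite ?mul0r //; rewrite (hD _ _ abc) in abND.
Qed.

Lemma fps_mulA : associative fps_mul.
Proof.
move=> f g h; apply/fpsP => m.
have hD a b : mmul a b = m -> a \in sub_monomials m.
  by move=> <-; apply: mem_sub_monomials.
rewrite fps_mulC !(fps_mul3E _ _ _ hD) [RHS]exchange_big /=.
apply: eq_bigr => b _; rewrite [RHS]exchange_big /=.
apply: eq_bigr => c _; apply: eq_bigr => a _.
by rewrite [mmul _ a]mulmC mulmA [_ * fcoef f a]mulrC [fcoef f a * (_ * _)]mulrA.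
Qed.

Lemma fps_mul1 : left_id fps_one fps_mul.
Proof.
move=> f; apply/fpsP => m; rewrite /fps_mul /=.
have m1 : (mone, m) \in factors m by rewrite mem_factors /= mul1m.
rewrite (big_fsetD1 _ m1) /= eqxx mul1r big_seq big1 ?addr0 // => -[a b].
rewrite in_fsetD1 mem_factors => /andP[abN /eqP /= abm].
have [a1|_] := eqVneq a mone; last by rewrite mul0r.
by move: abN; rewrite -abm a1 mul1m eqxx.
Qed.

Lemma fps_mulDl : left_distributive fps_mul fps_add.
Proof.
move=> f g h; apply/fpsP => m; rewrite /fps_mul /= -big_split /=.
by apply: eq_bigr => p _; rewrite mulrDl.
Qed.

Lemma fps_one_neq0 : fps_one != 0.
Proof.
by apply/eqP => /fpsP/(_ mone) /eqP; rewrite /= eqxx oner_eq0.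
Qed.

HB.instance Definition _ := GRing.Zmodule_isComNzRing.Build (fps I R)
  fps_mulA fps_mulC fps_mul1 fps_mulDl fps_one_neq0.

End FPSRing.

Section FPSUnit.
Variables (I : choiceType) (R : comNzRingType).
Implicit Types (f g h : fps I R) (a b m : {cmonom I}).

Definition fps_unit f : bool := `[< exists g, g * f = 1 >].
Definition fps_inv f : fps I R :=
  if pselect (exists g, g * f = 1) is left fV then sval (cid fV) else f.

Lemma fps_mulV : {in fps_unit, left_inverse 1 fps_inv *%R}.
Proof.
move=> f /asboolP fU; rewrite /fps_inv; case: pselect => // fV.
exact: (svalP (cid fV)).
Qed.

Lemma fps_unitPl f g : g * f = 1 -> fps_unit f.
Proof. by move=> gf; apply/asboolP; exists g. Qed.

Lemma fps_inv_out : {in [predC fps_unit], fps_inv =1 id}.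
Proof. by move=> f /asboolPn fNU; rewrite /fps_inv; case: pselect. Qed.

HB.instance Definition _ := GRing.ComNzRing_hasMulInverse.Build (fps I R)
  fps_mulV fps_unitPl fps_inv_out.

Lemma fcoef0 m : fcoef (0 : fps I R) m = 0. Proof. by []. Qed.
Lemma fcoef1 m : fcoef (1 : fps I R) m = (m == mone)%:R. Proof. by []. Qed.
Lemma fcoefN f m : fcoef (- f) m = - fcoef f m. Proof. by []. Qed.
Lemma fcoefD f g m : fcoef (f + g) m = fcoef f m + fcoef g m.
Proof. by []. Qed.
Lemma fcoefB f g m : fcoef (f - g) m = fcoef f m - fcoef g m.
Proof. by []. Qed.
Lemma fcoefM f g m :
  fcoef (f * g) m = \sum_(p <- factors m) fcoef f p.1 * fcoef g p.2.
Proof. by []. Qed.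

Lemma fcoef_sum (T : Type) (r : seq T) (P : pred T) (F : T -> fps I R) m :
  fcoef (\sum_(i <- r | P i) F i) m = \sum_(i <- r | P i) fcoef (F i) m.
Proof. by elim/big_rec2: _ => // i x y _ <-. Qed.

Lemma fcoefM1 f g : fcoef (f * g) mone = fcoef f mone * fcoef g mone.
Proof.
rewrite fcoefM; have -> : @factors I mone = [fset (mone, mone)].
  apply/fsetP => -[a b]; rewrite mem_factors in_fset1 xpair_eqE.
  apply/eqP/andP => /= [/unitm[-> ->]|[/eqP-> /eqP->]]; last exact: mul1m.
  by split; apply: eqxx.
by rewrite big_seq_fset1.
Qed.

Lemma fcoefX_eq0 h k m :
  fcoef h mone = 0 -> (mdeg m < k)%N -> fcoef (h ^+ k) m = 0.
Proof.
move=> h1; elim: k m => // k IH m mk; rewrite exprS fcoefM big_seq big1 //.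
case=> a b; rewrite mem_factors => /eqP /= abm.
have [->|aN1] := eqVneq a mone; first by rewrite h1 mul0r.
rewrite IH ?mulr0 //; move: mk; rewrite -abm mdegM ltnS; apply: leq_trans.
by rewrite -[ltnLHS]add0n ltn_add2r lt0n mdeg_eq0.
Qed.

Lemma fps_unit_1B h : fcoef h mone = 0 -> 1 - h \is a GRing.unit.
Proof.
move=> h1; pose G N := \sum_(k < N) h ^+ k.
pose g := FPS (fun m => fcoef (G (mdeg m).+1) m).
apply: (@fps_unitPl _ g); apply/fpsP => m.
transitivity (fcoef (G (mdeg m).+1 * (1 - h)) m); last first.
  rewrite mulrC -opprB mulNr -subrX1 opprB fcoefB fcoefX_eq0 ?subr0 //.
rewrite !fcoefM; apply: eq_fbigr => -[a b]; rewrite mem_factors => /eqP /= abm _.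
congr (_ * _); rewrite /= /G !fcoef_sum.
have le : ((mdeg a).+1 <= (mdeg m).+1)%N by rewrite ltnS -abm mdegM leq_addr.
rewrite (big_ord_widen _ (fun k => fcoef (h ^+ k) a) le) big_mkcond /=.
apply: eq_bigr => k _; case: ifPn => //; rewrite -leqNgt => ak.
by rewrite fcoefX_eq0.
Qed.

Lemma fps_unit_const f c :
  c * fcoef f mone = 1 -> f \is a GRing.unit.
Proof.
move=> cf1; pose f' := FPS (fun m => c * fcoef f m).
have f'U : f' \is a GRing.unit.
  rewrite -[f'](subKr 1); apply: fps_unit_1B.
  by rewrite fcoefB fcoef1 eqxx /= cf1 subrr.
apply: (@fps_unitPl _ (FPS (fun m => fcoef f'^-1 m * c))).
rewrite -[1 in RHS](mulVr f'U); apply/fpsP => m; rewrite !fcoefM.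
by apply: eq_bigr => p _ /=; rewrite mulrA.
Qed.

Definition fps_var (i : I) : fps I R := FPS (fun m => (m == ucm i)%:R).

(* Coefficientwise convergence: every coefficient is eventually constant. *)
Definition fps_cvg (u : nat -> fps I R) (F : fps I R) : Prop :=
  forall m, exists N, forall n, (N <= n)%N -> fcoef (u n) m = fcoef F m.

End FPSUnit.

(* A permutation of length [n] is an [s : 'S_n], with positions and values
   numbered from 0. *)

Section Statistics.
Variables (n : nat) (s : 'S_n).

Definition avoids132 : bool :=
  ~~ [exists a : 'I_n, exists b : 'I_n, exists c : 'I_n,
       [&& a < b, b < c, s a < s c & s c < s b]%N].

(* [t] stands for (i, i + 1, (j_3, ..., j_k)) where [k = l + 2] *)
Definition is_occurrence l (t : 'I_n * 'I_n * l.-tuple 'I_n) : bool :=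
  let: (i, i', js) := t in
  [&& i' == i.+1 :> nat, path ltn i' (map val js),
      (s i' < s i)%N & path ltn (s i) (map (fun j => val (s j)) js)].

(* The statistic f_k, which is only used for [k > 0]; for [k = 2] the
   tuple [js] is empty and the occurrences are the descents. *)
Definition stat (k : nat) : nat :=
  match k with
  | 0 => 0
  | 1 => n
  | l.+2 => #|[set t : 'I_n * 'I_n * l.-tuple 'I_n | is_occurrence t]|
  end.

Lemma stat_eq0 k : (n < k)%N -> stat k = 0%N.
Proof.
case: k => [|[|l]] //= nl; first by move: nl; rewrite ltnS leqn0 => /eqP.
apply/eqP; rewrite cards_eq0; apply/eqP/setP => -[[i i'] js]; rewrite !inE.
apply/negP => /and4P[/eqP ii' ijs _ _].
have : sorted ltn (map val [:: i, i' & js]) by rewrite /= ii' leqnn -ii'.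
move=> /(sorted_uniq ltn_trans ltnn); rewrite (map_inj_uniq val_inj).
move=> /card_uniqP /= E; have := max_card (mem [:: i, i' & js]).
by rewrite E size_tuple card_ord leqNgt nl.
Qed.

End Statistics.

(* The indeterminate [x_ 0] of [fps nat int] plays no role. *)

Definition x_ (k : nat) : fps nat int := fps_var int k.

(* By [stat_eq0] the omitted factors, those with [k > n], are all 1. *)
Definition weight n (s : 'S_n) : fps nat int :=
  \prod_(1 <= k < n.+1) x_ k ^+ stat s k.

Definition P (n : nat) : fps nat int :=
  \prod_(0 <= k < n.+1) x_ (k + 2) ^+ 'C(n, k).

(* The continued fraction
     1 - x_1 / (x_1 P_n - 1 / (1 - x_1 / (x_1 P_(n+1) - 1 / ...)))
   stopped after [d] layers, at the entry 1 of the next one. Stopping at an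
   entry [x_1 * P_j] instead would not give a formal power series: that entry
   is not invertible, and the first such convergent is 1 - 1 / x_2. *)
Fixpoint convergent (n d : nat) : fps nat int :=
  if d is d'.+1 then
    1 - x_ 1 / (x_ 1 * P n - 1 / convergent n.+1 d')
  else 1.

Lemma convergentS n d : convergent n d.+1 =
  1 - x_ 1 / (x_ 1 * P n - 1 / convergent n.+1 d).
Proof. by []. Qed.

(* All the divisions in [convergent] are by invertible power series. *)
Lemma convergent_units n d :
  convergent n d \is a GRing.unit /\
  x_ 1 * P n - 1 / convergent n.+1 d \is a GRing.unit.
Proof.
have x1 : fcoef (x_ 1) mone = 0.
  by rewrite /= eq_sym; case: eqP => // /(congr1 (@mdeg _)); rewrite mdeg1 mdegU.
have den k F : fcoef F mone = 1 ->
    fcoef (x_ 1 * P k - 1 / F) mone = -1.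
  move=> F1; have FU : F \is a GRing.unit.
    by apply: (@fps_unit_const _ _ _ 1); rewrite mul1r.
  rewrite fcoefB fcoefM1 x1 mul0r sub0r mul1r; congr (- _).
  by rewrite -[LHS]mul1r -F1 -fcoefM1 mulrV // fcoef1 eqxx.
have c1 k e : fcoef (convergent k e) mone = 1.
  case: e => [|e]; first by rewrite fcoef1 eqxx.
  by rewrite convergentS fcoefB fcoef1 eqxx fcoefM1 x1 mul0r subr0.
split; first by apply: (@fps_unit_const _ _ _ 1); rewrite c1 mul1r.
by apply: (@fps_unit_const _ _ _ (-1)); rewrite den ?c1 // mulrNN mul1r.
Qed.

(* Main.v *)
Require Import Defs.
From HB Require Import structures.
From mathcomp Require Import all_boot all_order all_fingroup all_algebra.
From mathcomp Require Import monalg zify ring.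

(** A nonempty 132-avoiding permutation is [u M v] with [M] its maximum, [u] and
    [v] 132-avoiding, and every entry of [u] above every entry of [v].  An
    occurrence of 21-3-...-k in it lies in [u], or in [v], or is an occurrence of
    21-3-...-(k-1) in [u] completed by [M], or is the descent from [M] to the
    first entry of [v].  Hence, if [A_n] is the generating function in which
    21-3-...-k has weight [prod_j x_(k+j)^C(n,j)], then Pascal's rule gives
    [A_n = 1 + x_1 A_(n+1) (1 + P_n (A_n - 1))], that is
    [A_n = 1 - x_1 / (x_1 P_n - 1 / A_(n+1))].  The convergents satisfy the same
    equation, so they agree with the partial sums of [A_n] modulo growing powers
    of [x_1]. *)

Set Implicit Arguments.
Unset Strict Implicit.
Unset Printing Implicit Defensive.

Import GRing.Theory.

(** * Avoidance of 1-3-2 by words of natural numbers *)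

Fixpoint av132 (w : seq nat) : bool :=
  if w is a :: w' then
    pairwise (fun b c => ~~ (a < c < b)) w' && av132 w'
  else true.

Lemma av132P (w : seq nat) :
  reflect (forall i j k, i < j -> j < k -> k < size w ->
             ~~ (nth 0 w i < nth 0 w k < nth 0 w j))
          (av132 w).
Proof.
elim: w => [|a w IH] /=; first by constructor.
apply: (iffP andP) => [[/(pairwiseP 0) pw /IH{}IH] [|i] [|j] [|k] //= | H].
  by move=> _ jk kw; apply: pw; rewrite ?inE //; apply: ltn_trans jk kw.
  by rewrite !ltnS; apply: IH.
split; last by apply/IH => i j k ij jk kw; apply: (H i.+1 j.+1 k.+1).
by apply/(pairwiseP 0) => j k _; rewrite inE => kw jk; apply: (H 0 j.+1 k.+1).
Qed.

Lemma av132_shift k (w : seq nat) : av132 (map (addn k) w) = av132 w.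
Proof.
elim: w => //= a w ->; congr (_ && _); rewrite pairwise_map.
by apply: eq_pairwise => b c /=; rewrite !ltn_add2l.
Qed.

(** Across the cut [M] can only play the 3; the triples [a], [M], [c] then force [c < a], equality
    being excluded by distinctness. Conversely, these inequalities forbid a 1 in [u] together with a
    2 in [v], so no pattern straddles [M]. *)
Lemma av132_cat_max (u v : seq nat) M :
    all (gtn M) (u ++ v) -> uniq (u ++ v) ->
  av132 (u ++ M :: v) = [&& av132 u, av132 v & allrel (fun a c => c < a) u v].
Proof.
elim: u => [|a u IH] /=.
  move=> vM _; rewrite allrel0l andbT andb_idl // => _.
  elim: v vM => //= c v IH /andP[cM vM]; rewrite IH // andbT.
  by apply/allP => d dv /=; move/allP: vM => /(_ d dv) /=; lia.
move=> /andP[aM uvM] /andP[auv uv]; rewrite IH // allrel_consl.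
move: uvM auv; rewrite all_cat mem_cat negb_or => /andP[uM vM] /andP[_ av].
rewrite pairwise_cat /=.
have -> : all (fun c => ~~ (a < c < M)) v = all (fun c => c < a) v.
  apply: eq_in_all => c cv; have /= := allP vM c cv.
  by have : c != a by [apply: contraNneq av => <-]; lia.
have [va|] := boolP (all (fun c => c < a) v); last by rewrite !andbF.
have -> : pairwise (fun b c => ~~ (a < c < b)) v.
  elim: v va {IH uv vM av} => //= c v IH /andP[ca va]; rewrite IH // andbT.
  by apply/allP => d dv /=; move/allP: va => /(_ d dv) /=; lia.
have -> : allrel (fun b c => ~~ (a < c < b)) u (M :: v).
  apply/allrelP => b c bu; rewrite inE => /orP[/eqP->|cv].
    by have /= := allP uM b bu; lia.
  by have /= := allP va c cv; lia.
by rewrite /= andbT !andbA.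
Qed.

(** * Counting occurrences of 21-3-...-k in words *)

(* [inc l c w] counts the increasing subsequences of [w] of length [l] with
   all entries above [c]; [occ l w] counts the occurrences of
   21-3-...-(l + 2) in [w]. *)
Fixpoint inc (l c : nat) (w : seq nat) : nat :=
  match w, l with
  | _, 0 => 1
  | [::], _ => 0
  | y :: w', l'.+1 => inc l c w' + (c < y) * inc l' y w'
  end.

Fixpoint occ (l : nat) (w : seq nat) : nat :=
  if w is a :: w' then
    (if w' is b :: w'' then (b < a) * inc l a w'' else 0) + occ l w'
  else 0.

Lemma inc0 c w : inc 0 c w = 1. Proof. by case: w. Qed.

Lemma inc_eq0 l c w : size w < l -> inc l c w = 0.
Proof.
elim: w l c => [|y w IH] [|l] c //= h.
by rewrite !IH ?muln0 // ltnW.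
Qed.

Lemma occ_eq0 l w : size w <= l -> occ l w = 0.
Proof.
elim: w l => [|a w IH] l //= h; rewrite IH ?addn0 1?ltnW //.
by case: w h {IH} => [|b w] //= h; rewrite inc_eq0 ?muln0 //; lia.
Qed.

Lemma inc_shift k l c w : inc l (k + c) (map (addn k) w) = inc l c w.
Proof. by elim: w l c => [|y w IH] [|l] c //=; rewrite !IH ltn_add2l. Qed.

Lemma occ_shift k l w : occ l (map (addn k) w) = occ l w.
Proof.
elim: w => //= a w ->; congr (_ + _).
by case: w => //= b w; rewrite inc_shift ltn_add2l.
Qed.

Lemma inc_above l c w : all (gtn c.+1) w -> inc l c w = (l == 0).
Proof.
elim: w l => [|y w IH] [|l] //= /andP[yc wc].
by rewrite IH // ltnNge -ltnS yc.
Qed.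

(** All of [v] lies below [c], so a counted subsequence lies in [u] or is a shorter one in [u]
    completed by [M]. *)
Lemma inc_cat_max l c u M v :
    all (gtn M) (c :: u) -> all (fun b => all (gtn b) v) (c :: u) ->
  inc l c (u ++ M :: v) = inc l c u + (if l is l'.+1 then inc l' c u else 0).
Proof.
elim: u c l => [|y u IH] c [|l] /=; rewrite ?inc0 // => + /andP[vc].
  move=> /andP[cM _] _; rewrite cM inc_above; last first.
    by apply: sub_all vc => b /= bc; apply: ltnW.
  rewrite inc_above; last by apply: sub_all vc => b /=; lia.
  by case: l.
move=> /and3P[cM yM uM] /andP[vy vu].
rewrite (IH c) /= ?cM ?vc // (IH y) /= ?yM ?vy //.
by case: l => [|l] /=; rewrite ?inc0; lia.
Qed.

(** The step from [u] to [M] is an ascent, a descent inside [u] can be continued only within [u] and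
    by [M], and the descent out of [M] cannot be continued since nothing exceeds [M]. *)
Lemma occ_cat_max l u M v :
    all (gtn M) (u ++ v) -> allrel (fun a c => c < a) u v ->
  occ l (u ++ M :: v) =
  occ l u + (if l is l'.+1 then occ l' u else 0)
  + ((l == 0) && (v != [::])) + occ l v.
Proof.
elim: u => [|a u IH] /=.
  move=> vM _; rewrite add0n; case: v vM => [|b v] /=; first by case: l.
  move=> /andP[bM vM]; rewrite bM mul1n inc_above ?andbT; first by case: l.
  by apply: sub_all vM => c /=; lia.
move=> /andP[aM uvM]; rewrite allrel_consl => /andP[va vu].
rewrite IH //; case: u uvM vu {IH} => [|b u] /= uvM vu.
  by rewrite ltnNge ltnW //=; case: l.
case/andP: uvM => bM; rewrite all_cat => /andP[uM vM].
rewrite allrel_consl in vu; case/andP: vu => vb vu.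
rewrite inc_cat_max; first by case: l => [|l]; lia.
  by rewrite /= aM.
by rewrite /= va.
Qed.

(** * Decomposition of avoiding words at their maximum *)

Definition av132_words (n : nat) : seq (seq nat) :=
  [seq w <- permutations (iota 0 n) | av132 w].

Lemma mem_av132_words n w :
  (w \in av132_words n) = av132 w && perm_eq w (iota 0 n).
Proof. by rewrite mem_filter mem_permutations. Qed.

Lemma size_av132_words n w : w \in av132_words n -> size w = n.
Proof. by rewrite mem_av132_words => /andP[_ /perm_size->]; rewrite size_iota. Qed.

(** For permutations [u] and [v] of initial segments starting at 0, [v] keeps the smallest values,
    [u] is raised just above them, and the next value is the maximum. *)
Definition join132 (u v : seq nat) : seq nat :=
  map (addn (size v)) u ++ (size u + size v) :: v.

Lemma join132_gt (u v : seq nat) i j :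
    u \in av132_words i -> v \in av132_words j ->
  all (gtn (i + j)) (map (addn j) u ++ v) /\
  allrel (fun a c => c < a) (map (addn j) u) v.
Proof.
rewrite !mem_av132_words => /andP[_ pu] /andP[_ pv].
split.
  apply/allP => x; rewrite mem_cat => /orP[/mapP[y yu ->]|].
    by move: yu; rewrite (perm_mem pu) mem_iota /=; lia.
  by rewrite (perm_mem pv) mem_iota /=; lia.
apply/allrelP => x y /mapP[z _ ->]; rewrite (perm_mem pv) mem_iota; lia.
Qed.

Lemma join132_in (u v : seq nat) i j :
    u \in av132_words i -> v \in av132_words j ->
  join132 u v \in av132_words (i + j).+1.
Proof.
move=> ui vj; have [lt gt] := join132_gt ui vj.
rewrite /join132 (size_av132_words ui) (size_av132_words vj).
move: ui vj; rewrite !mem_av132_words => /andP[avu pu] /andP[avv pv].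
have puv : perm_eq (map (addn j) u ++ v) (iota 0 (i + j)).
  rewrite addnC iotaD add0n perm_catC perm_cat // -[j in iota j _]addn0 iotaDl.
  exact: perm_map.
rewrite -[(i + j).+1]addn1 av132_cat_max // ?av132_shift ?avu ?avv ?gt /=;
  last first.
  by rewrite (perm_uniq puv) iota_uniq.
by rewrite -cat1s perm_catCA perm_catC iotaD add0n perm_cat.
Qed.

(** Sorting [v] and [u] separately and concatenating yields a sorted permutation of [iota 0 n],
    hence [iota 0 n] itself; cutting it at [size v] identifies both blocks. *)
Lemma perm_iota_split (u v : seq nat) n :
    perm_eq (u ++ v) (iota 0 n) -> allrel (fun a c => c < a) u v ->
  perm_eq u (iota (size v) (size u)) /\ perm_eq v (iota 0 (size v)).
Proof.
move=> puv gt.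
have n_eq : n = size v + size u.
  by rewrite addnC -size_cat (perm_size puv) size_iota.
have E : sort leq v ++ sort leq u = iota 0 n.
  apply: (sorted_eq leq_trans anti_leq).
  - rewrite (sorted_pairwise leq_trans) pairwise_cat.
    rewrite -!(sorted_pairwise leq_trans) !(sort_sorted leq_total) !andbT.
    apply/allrelP => x y; rewrite !mem_sort => xv yu.
    by apply: ltnW; apply: (allrelP gt).
  - exact: iota_sorted.
  - rewrite perm_catC; apply: perm_trans puv.
    by rewrite perm_cat // perm_sort.
move/eqP: E; rewrite n_eq iotaD eqseq_cat ?size_sort ?size_iota // add0n.
by case/andP=> /eqP <- /eqP <-; rewrite !(perm_sym _ (sort _ _)) !perm_sort.
Qed.

Lemma join132_surj n (w : seq nat) : w \in av132_words n.+1 ->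
  exists u v, [/\ size u <= n, u \in av132_words (size u),
                  v \in av132_words (n - size u) & w = join132 u v].
Proof.
rewrite mem_av132_words => /andP[avw pw].
have nw : n \in w by rewrite (perm_mem pw) mem_iota /=; lia.
case/splitPr: nw avw pw => u v avw pw.
have puv : perm_eq (u ++ v) (iota 0 n).
  rewrite -(perm_cons n) -cat1s perm_catCA cat1s (perm_trans pw) //.
  by rewrite -addn1 iotaD perm_catC.
have lt : all (gtn n) (u ++ v).
  by apply/allP => x; rewrite (perm_mem puv) mem_iota.
have := av132_cat_max lt; rewrite (perm_uniq puv) iota_uniq avw => /(_ isT).
move=> /esym/and3P[avu avv gt].
have [pu pv] := perm_iota_split puv gt.
have n_eq : size u + size v = n.
  by rewrite -size_cat (perm_size puv) size_iota.
(* This undoes the shift in [join132]; the subtraction never truncates, as all entries of [u] are at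
   least [size v]. *)
pose u' := map (subn^~ (size v)) u.
have uE : u = map (addn (size v)) u'.
  rewrite -map_comp map_id_in // => x; rewrite (perm_mem pu) mem_iota /=; lia.
have su : size u' = size u by rewrite size_map.
exists u', v; rewrite su; split; first by lia.
- rewrite mem_av132_words -(av132_shift (size v)) -uE avu /=.
  apply: (@perm_map_inj _ _ (addn (size v))); first exact: addnI.
  by rewrite -uE -iotaDl addn0.
- have -> : n - size u = size v by lia.
  by rewrite mem_av132_words avv.
- by rewrite /join132 su -uE n_eq.
Qed.

Lemma join132_inj i j i' j' u v u' v' :
    u \in av132_words i -> v \in av132_words j ->
    u' \in av132_words i' -> v' \in av132_words j' ->
  join132 u v = join132 u' v' -> (u, v) = (u', v').
Proof.
move=> ui vj ui' vj' E.
have [+ _] := join132_gt ui vj; have [+ _] := join132_gt ui' vj'.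
rewrite -(size_av132_words ui) -(size_av132_words vj).
rewrite -(size_av132_words ui') -(size_av132_words vj').
have n_eq : size u + size v = size u' + size v'.
  by move: (congr1 size E); rewrite !size_cat /= !size_map; lia.
rewrite !all_cat => /andP[lt' _] /andP[lt _].
(* The position of the maximum reveals the length of the first block. *)
have iE x y : all (gtn (size x + size y)) (map (addn (size y)) x) ->
    index (size x + size y) (join132 x y) = size x.
  move=> lt0; rewrite index_cat /= eqxx addn0 size_map ifN //.
  by apply/negP => /(allP lt0) /=; rewrite ltnn.
have su : size u = size u' by rewrite -(iE _ _ lt) -(iE _ _ lt') E n_eq.
have sv : size v = size v' by lia.
move/eqP: E; rewrite /join132 eqseq_cat ?size_map // eqseq_cons su sv eqxx /=.
case/andP => /eqP/inj_map E /eqP ->; rewrite E //; exact: addnI.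
Qed.

Lemma sum_av132_wordsS (R : nmodType) n (G : seq nat -> R) :
  (\sum_(w <- av132_words n.+1) G w =
   \sum_(i < n.+1) \sum_(u <- av132_words i) \sum_(v <- av132_words (n - i))
      G (join132 u v))%R.
Proof.
pose t i := [seq (u, v) | u <- av132_words i, v <- av132_words (n - i)].
pose L := [seq join132 p.1 p.2 | i <- iota 0 n.+1, p <- t i].
have Uw k : uniq (av132_words k) by rewrite filter_uniq ?permutations_uniq.
have tP i p : p \in t i ->
    p.1 \in av132_words i /\ p.2 \in av132_words (n - i).
  by case/allpairsP => -[u v] /= [ui vi ->].
rewrite (perm_big L) /=; last first.
  apply: uniq_perm => //.
    apply: allpairs_uniq_dep; first exact: iota_uniq.
      by move=> i _; apply: allpairs_uniq => // -[a b] [c d] _ _ [-> ->].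
    move=> q q' /allpairsPdep[i [p [_ pt ->]]] /allpairsPdep[i' [p' [_ pt' ->]]].
    have [p1 p2] := tP _ _ pt; have [p1' p2'] := tP _ _ pt'.
    rewrite /= => /(join132_inj p1 p2 p1' p2'); rewrite -!surjective_pairing.
    (* The index [i] is recovered as the length of the first word. *)
    move=> pp'; rewrite -pp' in p1' *.
    by rewrite -(size_av132_words p1) (size_av132_words p1').
  move=> w; apply/idP/allpairsPdep.
    move=> /join132_surj [u [v [un uw vw ->]]].
    exists (size u), (u, v); rewrite mem_iota; split=> //=; apply/allpairsP.
    by exists (u, v).
  case=> i [p [+ /tP[p1 p2] ->]]; rewrite mem_iota => /= ilt.
  by have := join132_in p1 p2; rewrite subnKC.
rewrite big_allpairs_dep -[iota 0 n.+1]/(index_iota 0 n.+1) big_mkord.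
by apply: eq_bigr => i _; rewrite big_allpairs_dep.
Qed.

(** * Permutations in one-line notation *)

Section PermWord.
Variables (n : nat).
Implicit Type s : 'S_n.

Definition perm_word s : seq nat := [seq val (s i) | i <- enum 'I_n].

Lemma size_perm_word s : size (perm_word s) = n.
Proof. by rewrite size_map size_enum_ord. Qed.

Lemma nth_perm_word s (i : 'I_n) : nth 0 (perm_word s) i = s i.
Proof. by rewrite (nth_map i) ?size_enum_ord // nth_ord_enum. Qed.

Lemma perm_word_inj : injective perm_word.
Proof.
by move=> s s' E; apply/permP => i; apply: val_inj; rewrite /= -!nth_perm_word E.
Qed.

Lemma perm_word_perm s : perm_eq (perm_word s) (iota 0 n).
Proof.
rewrite -val_enum_ord /perm_word map_comp perm_map //.
apply: uniq_perm; rewrite ?enum_uniq ?(map_inj_uniq perm_inj) ?enum_uniq //.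
by move=> i; rewrite mem_enum -(permKV s i) mem_map ?mem_enum //; apply: perm_inj.
Qed.

Lemma perm_word_surj w : perm_eq w (iota 0 n) -> exists s, perm_word s = w.
Proof.
move=> pw; have sw : size w = n by rewrite (perm_size pw) size_iota.
have lt (i : 'I_n) : nth 0 w i < n.
  have : nth 0 w i \in w by rewrite mem_nth ?sw.
  by rewrite (perm_mem pw) mem_iota.
have inj : injective (fun i => Ordinal (lt i)).
  move=> i j /(congr1 val) /= /eqP; rewrite nth_uniq ?sw // => [/eqP/val_inj //|].
  by rewrite (perm_uniq pw) iota_uniq.
exists (perm inj); apply: (@eq_from_nth _ 0); rewrite size_perm_word ?sw //.
by move=> i ltin; rewrite (nth_perm_word _ (Ordinal ltin)) permE.
Qed.

Lemma avoids132E s : avoids132 s = av132 (perm_word s).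
Proof.
apply/idP/av132P => [|H].
  move=> H i j k ij jk; rewrite size_perm_word => kn; apply: contra H.
  have jn := ltn_trans jk kn; have iN := ltn_trans ij jn.
  rewrite (nth_perm_word s (Ordinal iN)) (nth_perm_word s (Ordinal jn)).
  rewrite (nth_perm_word s (Ordinal kn)) => /andP[h1 h2].
  apply/existsP; exists (Ordinal iN); apply/existsP; exists (Ordinal jn).
  by apply/existsP; exists (Ordinal kn); apply/and4P.
apply/existsP => -[a /existsP[b /existsP[c /and4P[ab bc ac cb]]]].
have := H _ _ _ ab bc; rewrite size_perm_word ltn_ord !nth_perm_word ac cb.
by move=> /(_ isT).
Qed.

Lemma sum_avoids132 (R : nmodType) (G : seq nat -> R) :
  (\sum_(s : 'S_n | avoids132 s) G (perm_word s) =
   \sum_(w <- av132_words n) G w)%R.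
Proof.
rewrite -big_filter.
rewrite -(big_map perm_word xpredT G); apply: perm_big.
apply: uniq_perm.
- by rewrite (map_inj_uniq perm_word_inj) filter_uniq ?index_enum_uniq.
- by rewrite filter_uniq ?permutations_uniq.
move=> w; rewrite mem_av132_words; apply/mapP/andP => /= [[s]|[avw]].
  by rewrite mem_filter avoids132E => /andP[avs _] ->; rewrite perm_word_perm.
move=> /perm_word_surj[s sw]; exists s => //.
by rewrite mem_filter avoids132E sw avw mem_index_enum.
Qed.

End PermWord.

(** * The statistics as recursive counts on words *)

Lemma inc_sum l c w :
  inc l.+1 c w = \sum_(0 <= j < size w | c < nth 0 w j)
                    inc l (nth 0 w j) (drop j.+1 w).
Proof.
elim: w => [|y w IH] /=; first by rewrite big_geq.
rewrite IH [RHS]big_mkcond big_nat_recl //= drop0 addnC -big_mkcond /=.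
by case: (c < y); rewrite ?mul1n.
Qed.

Lemma occ_sum l w :
  occ l w = \sum_(0 <= i < size w | (i.+1 < size w) && (nth 0 w i.+1 < nth 0 w i))
              inc l (nth 0 w i) (drop i.+2 w).
Proof.
elim: w => [|a w IH] /=; first by rewrite big_geq.
rewrite IH [RHS]big_mkcond big_nat_recl //= -big_mkcond /=; congr (_ + _).
by case: w {IH} => [|b w] //=; rewrite drop0; case: (b < a); rewrite ?mul1n.
Qed.

Section StatWord.
Variables (n : nat) (s : 'S_n).

(** Here [p] bounds positions and [c] bounds values. Splitting off the first index [j] replaces
    these bounds by [j] and [s j]. *)
Lemma card_increasing_tuples l p c :
  #|[set js : l.-tuple 'I_n | path ltn p (map val js) &&
                              path ltn c (map (fun j => val (s j)) js)]| =
  inc l c (drop p.+1 (perm_word s)).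
Proof.
elim: l p c => [|l IH] p c.
  rewrite inc0; transitivity #|{: 0.-tuple 'I_n}|; last by rewrite card_tuple.
  by apply: eq_card => t; rewrite !inE tuple0.
rewrite inc_sum size_drop size_perm_word -sum1dep_card.
rewrite (reindex (fun q : 'I_n * l.-tuple 'I_n => [tuple of q.1 :: q.2])) /=;
  last first.
  exists (fun t => (thead t, [tuple of behead t])) => [[j t]|t] _ /=.
    by rewrite theadE; congr (_, _); apply: val_inj.
  by rewrite [RHS]tuple_eta.
transitivity (\sum_(j < n | (p < j) && (c < s j))
                 inc l (s j) (drop j.+1 (perm_word s))).
  under [RHS]eq_bigr => j _ do rewrite -(IH j (s j)) -sum1dep_card.
  rewrite pair_big_dep; apply: eq_bigl => -[j t] /=.
  by rewrite -!andbA; do !bool_congr.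
transitivity (\sum_(0 + p.+1 <= j < n | c < nth 0 (perm_word s) j)
                 inc l (nth 0 (perm_word s) j) (drop j.+1 (perm_word s))).
  rewrite big_geq_mkord; apply: eq_big => [j|j _]; last by rewrite nth_perm_word.
  by rewrite nth_perm_word andbC.
rewrite big_addn; apply: eq_big => [j|j _]; rewrite nth_drop addnC //.
by rewrite drop_drop !addSn addnS addnC.
Qed.

Lemma stat_perm_word l : stat s l.+2 = occ l (perm_word s).
Proof.
rewrite occ_sum size_perm_word /= big_mkord -sum1dep_card.
transitivity (\sum_(q : 'I_n * 'I_n | (q.2 == q.1.+1 :> nat) && (s q.2 < s q.1))
   inc l (s q.1) (drop q.2.+1 (perm_word s))).
  under [RHS]eq_bigr => q _ do
    rewrite -card_increasing_tuples -sum1dep_card.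
  rewrite pair_big_dep; apply: eq_bigl => -[[i i'] js] /=.
  by rewrite -!andbA; do !bool_congr.
rewrite -(pair_big_dep xpredT
  (fun i i' : 'I_n => (i' == i.+1 :> nat) && (s i' < s i))
  (fun i i' => inc l (s i) (drop i'.+1 (perm_word s)))) [RHS]big_mkcond /=.
apply: eq_bigr => i _; rewrite nth_perm_word.
have [ltin|geni] /= := ltnP i.+1 n; last first.
  by rewrite big_pred0 // => i'; have := ltn_ord i'; lia.
rewrite (nth_perm_word s (Ordinal ltin)).
rewrite big_mkcondr (big_pred1 (Ordinal ltin)) => [|i'] //=.
Qed.

End StatWord.

(** * Products of truncated power series *)

Local Open Scope ring_scope.

(** As [x] is an arbitrary ring element, congruence modulo [x ^+ N] is stated with an explicit
    multiple. The induction peels off [f 0], leaving [x] times the sum for the shifted [f]. *)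
Lemma truncated_cauchy (R : comNzRingType) (x : R) N (f g : nat -> R) :
  exists h, (\sum_(i < N) x ^+ i * f i) * (\sum_(i < N) x ^+ i * g i) =
    \sum_(k < N) x ^+ k * (\sum_(i < k.+1) f i * g (k - i)%N) + x ^+ N * h.
Proof.
elim: N f => [|N IH] f; first by exists 0; rewrite !big_ord0 !mulr0 addr0.
have [h E] := IH (fun i => f i.+1).
pose A := \sum_(i < N) x ^+ i * f i.+1.
(* The term [A * g N] comes from [x * A] times the last term [x ^+ N * g N] of the second factor. *)
exists (h + A * g N).
have fE : \sum_(i < N.+1) x ^+ i * f i = f 0%N + x * A.
  rewrite big_ord_recl expr0 mul1r mulr_sumr; congr (_ + _).
  by apply: eq_bigr => i _; rewrite exprS mulrA.
have -> : \sum_(k < N.+1) x ^+ k * (\sum_(i < k.+1) f i * g (k - i)%N) =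
    f 0%N * (\sum_(i < N.+1) x ^+ i * g i) +
    x * \sum_(k < N) x ^+ k * (\sum_(i < k.+1) f i.+1 * g (k - i)%N).
  transitivity (\sum_(k < N.+1) (f 0%N * (x ^+ k * g k) +
       x ^+ k * (\sum_(i < k) f i.+1 * g (k - i.+1)%N))).
    apply: eq_bigr => k _; rewrite big_ord_recl subn0 mulrDr; congr (_ + _).
    by rewrite mulrCA.
  rewrite big_split /= -mulr_sumr; congr (_ + _).
  rewrite big_ord_recl big_ord0 mulr0 add0r mulr_sumr.
  by apply: eq_bigr => k _; rewrite exprS mulrA.
rewrite fE [in LHS]big_ord_recr /= mulrDl -[x * A * _]mulrA.
rewrite mulrDr -/A [A * (_ + _)]mulrDr.
rewrite /A E -/A [in RHS]big_ord_recr /= exprS; ring.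
Qed.

(** * Weighted enumeration of avoiding words by length *)

Section WordWeights.
Variables (R : comNzRingType) (x : nat -> R).

(* The weight of an occurrence of 21-3-...-(l + 2) once [n] larger entries
   have been put to its right. *)
Fixpoint occ_wt (n l : nat) : R :=
  if n is n'.+1 then occ_wt n' l * occ_wt n' l.+1 else x (l + 2).

(** The recursion on [n] is Pascal's rule for the exponents. At [l = 0] the product is the entry
    [P n] of the fraction. *)
Lemma occ_wtE n l :
  occ_wt n l = \prod_(0 <= k < n.+1) x (l + k + 2) ^+ 'C(n, k).
Proof.
elim: n l => [|n IH] l /=; first by rewrite big_nat1 addn0 expr1.
rewrite !IH [RHS]big_nat_recl // bin0.
under [in RHS]eq_bigr => k _ do rewrite binS exprD.
rewrite big_split /= mulrA; congr (_ * _); last first.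
  by apply: eq_bigr => k _; rewrite addSnnS.
transitivity (\prod_(0 <= k < n.+2) x (l + k + 2) ^+ 'C(n, k)).
  by rewrite [RHS]big_nat_recr //= bin_small // mulr1.
by rewrite big_nat_recl // bin0.
Qed.

(** The power of [x 1] recording the length is left to [partial_sum]. *)
Definition word_wt n (w : seq nat) : R :=
  \prod_(l < size w) occ_wt n l ^+ occ l w.

Lemma word_wtE B n w : (size w <= B)%N ->
  word_wt n w = \prod_(l < B) occ_wt n l ^+ occ l w.
Proof.
move=> wB; rewrite /word_wt (big_ord_widen _ (fun l => occ_wt n l ^+ occ l w) wB).
rewrite big_mkcond; apply: eq_bigr => l _; case: ltnP => // wl.
by rewrite occ_eq0.
Qed.

(** An occurrence in [u] contributes [occ_wt n l] and, completed by the maximum, [occ_wt n l.+1];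
    the product is [occ_wt n.+1 l]. The extra factor is the descent into a nonempty [v]. *)
Lemma word_wt_join n i j u v :
    u \in av132_words i -> v \in av132_words j ->
  word_wt n (join132 u v) =
  word_wt n.+1 u * ((if j == 0%N then 1 else occ_wt n 0) * word_wt n v).
Proof.
move=> ui vj; have [lt gt] := join132_gt ui vj.
have su := size_av132_words ui; have sv := size_av132_words vj.
rewrite (@word_wtE (i + j).+1 _ (join132 u v)); last first.
  by rewrite size_cat size_map /= su sv addnS.
(* This bound is one less because completion by the maximum raises [l] by one. *)
rewrite (@word_wtE (i + j) _ u) ?su ?leq_addr //.
rewrite (@word_wtE (i + j).+1 _ v) ?sv; last by lia.
rewrite /join132 su sv.
under eq_bigr => l _.
  rewrite occ_cat_max // !exprD occ_shift.
  over.
rewrite !big_split /= mulrA; congr (_ * _); congr (_ * _).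
  rewrite -(@word_wtE _ n u) ?su; last by lia.
  rewrite (@word_wtE (i + j) _ u) ?su ?leq_addr // big_ord_recl mul1r.
  rewrite -big_split; apply: eq_bigr => l _ /=.
  by rewrite occ_shift exprMn.
rewrite big_ord_recl big1 ?mulr1 // -sv size_eq0.
by case: (v == [::]).
Qed.

Definition words_sum n N : R := \sum_(w <- av132_words N) word_wt n w.

Lemma words_sum0 n : words_sum n 0 = 1.
Proof. by rewrite /words_sum big_seq1 /word_wt big_ord0. Qed.

Lemma words_sumS n N : words_sum n N.+1 =
  \sum_(i < N.+1) words_sum n.+1 i *
     ((if (N - i)%N == 0%N then 1 else occ_wt n 0) * words_sum n (N - i)).
Proof.
rewrite /words_sum sum_av132_wordsS; apply: eq_bigr => i _.
rewrite mulr_suml big_seq [RHS]big_seq; apply: eq_bigr => u ui.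
rewrite !mulr_sumr big_seq [RHS]big_seq; apply: eq_bigr => v vj.
by rewrite (word_wt_join n ui vj).
Qed.

Definition partial_sum n N : R :=
  \sum_(k < N) x 1 ^+ k * words_sum n k.

(** This is the functional equation of [A_n] modulo [x 1 ^+ N.+1]; the factor [x 1] lets the sums on
    the right stop one term earlier. *)
Lemma partial_sumS n N : exists g, partial_sum n N.+1 =
  1 + x 1 * partial_sum n.+1 N * (1 + occ_wt n 0 * (partial_sum n N - 1))
  + x 1 ^+ N.+1 * g.
Proof.
(* Absorbing the descent weight into the second factor turns [words_sumS] into a plain
   convolution. *)
pose b j := (if j == 0%N then 1 else occ_wt n 0) * words_sum n j.
have [h E] := truncated_cauchy (x 1) N (words_sum n.+1) b.
exists (- h); rewrite /partial_sum big_ord_recl words_sum0 expr0 mul1r -!addrA.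
congr (_ + _).
have -> : \sum_(i < N) x 1 ^+ bump 0 i * words_sum n (bump 0 i) =
    x 1 * \sum_(k < N) x 1 ^+ k *
      (\sum_(i < k.+1) words_sum n.+1 i * b (k - i)%N).
  rewrite mulr_sumr; apply: eq_bigr => k _.
  by rewrite /bump add1n words_sumS exprS mulrA.
have /(canRL (addrK _)) -> := esym E.
(* For [N = 0] the sum of [b] lacks the constant term 1 used next, but both sums in the product are
   empty. *)
case: N {E} => [|N]; first by rewrite !big_ord0; ring.
have -> : \sum_(i < N.+1) x 1 ^+ i * b i =
    1 + occ_wt n 0 * (\sum_(k < N.+1) x 1 ^+ k * words_sum n k - 1).
  rewrite big_ord_recl [in RHS]big_ord_recl /b /= words_sum0 !expr0 !mul1r.
  rewrite addrAC subrr add0r mulr_sumr; congr (_ + _).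
  by apply: eq_bigr => i _; rewrite mulrCA.
by rewrite [x 1 ^+ N.+2]exprS; ring.
Qed.

End WordWeights.

(** * Comparison with the continued fraction *)

Lemma quadratic_of_fraction (R : comUnitRingType) (x p c : R) :
    c \is a GRing.unit -> x * p - 1 / c \is a GRing.unit ->
  let y := 1 - x / (x * p - 1 / c) in y = 1 + x * c * (1 + p * (y - 1)).
Proof.
move=> cU; set e := _ - _ => eU /=.
have ce : c * e = x * p * c - 1 by rewrite mulrBr mul1r mulrV // mulrC.
(* Multiplying by the unit [e] clears the outer division, and [ce] clears the inner one. *)
apply: (mulIr eU); rewrite [in RHS]mulrDl mulrBl divrK //.
have -> : x * c * (1 + p * (1 - x / e - 1)) * e =
    x * (c * e) - x * c * p * x * (e^-1 * e) by ring.
by rewrite mulVr // ce; ring.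
Qed.

(** Both approximations enter [t] through a product with [x], so errors of order [N] become errors
    of order [N.+1]. *)
Lemma quadratic_approx (R : comNzRingType) (x p y c s s' t g1 g2 g3 : R) N :
    y = 1 + x * c * (1 + p * (y - 1)) ->
    s' = c + x ^+ N * g1 -> s = y + x ^+ N * g2 ->
    t = 1 + x * s' * (1 + p * (s - 1)) + x ^+ N.+1 * g3 ->
  exists g, t = y + x ^+ N.+1 * g.
Proof.
move=> yE -> -> ->.
exists (g1 * (1 + p * (y - 1)) + c * p * g2 + x ^+ N * g1 * p * g2 + g3).
by rewrite {2}yE exprS; ring.
Qed.

(** Order [N.+1] at layer [n] and depth [d.+1] follows from order [N] at the same place and at layer
    [n.+1], depth [d]. *)
Lemma partial_sum_convergent N n d : (N <= d)%N ->
  exists g, partial_sum x_ n N = convergent n d + x_ 1 ^+ N * g.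
Proof.
elim: N n d => [|N IH] n d Nd.
  (* Modulo [x_ 1 ^+ 0 = 1] everything agrees, so the difference is a witness. *)
  exists (partial_sum x_ n 0 - convergent n d).
  by rewrite expr0 mul1r addrC subrK.
case: d Nd => // d Nd; have [g1 E1] := IH n.+1 d Nd.
have [g2 E2] := IH n d.+1 (ltnW Nd); have [g3 E3] := partial_sumS x_ n N.
have [_ dU] := convergent_units n d; have [cU _] := convergent_units n.+1 d.
rewrite occ_wtE in E3.
exact: (quadratic_approx (quadratic_of_fraction cU dU) E1 E2 E3).
Qed.

(** Since [x] has no constant term, a multiple of [x ^+ k] has no monomial of degree below [k]. *)
Lemma fcoef_eqmod (I : choiceType) (R : comNzRingType) (f g h x : fps I R) k m :
    fcoef x mone = 0 -> (mdeg m < k)%N -> f = g + x ^+ k * h ->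
  fcoef f m = fcoef g m.
Proof.
move=> x0 mk ->; rewrite fcoefD fcoefM big_seq big1 ?addr0 // => -[a b].
rewrite mem_factors => /eqP /= abm; rewrite fcoefX_eq0 ?mul0r //.
by apply: leq_ltn_trans mk; rewrite -abm mdegM leq_addr.
Qed.

Lemma weight_perm_word n (s : 'S_n) :
  weight s = x_ 1 ^+ n * word_wt x_ 0 (perm_word s).
Proof.
rewrite /weight; case: n s => [|n] s.
  by rewrite big_geq // /word_wt size_perm_word big_ord0 mulr1.
rewrite big_ltn //; congr (_ * _).
(* The last factor, [l = n], belongs to [k = n + 2], which exceeds the length [n + 1], so its
   exponent is 0. The others match under [k = l + 2]. *)
rewrite /word_wt size_perm_word big_ord_recr /= -stat_perm_word stat_eq0 // mulr1.
rewrite -(big_mkord xpredT (fun l => x_ (l + 2) ^+ occ l (perm_word s))).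
rewrite (big_addn 0 n.+2 2) subn2; apply: eq_bigr => l _.
by rewrite !addn2 stat_perm_word.
Qed.

Theorem theorem2p3 :
  exists F : fps nat int,
    fps_cvg (fun N : nat =>
      \sum_(0 <= n < N) \sum_(s : 'S_n | avoids132 s) weight s) F /\
    fps_cvg (convergent 0) F.
Proof.
have x1 : fcoef (x_ 1) mone = 0.
  by rewrite /= eq_sym; case: eqP => // /(congr1 (@mdeg _)); rewrite mdeg1 mdegU.
(* The coefficient at [m] is read from a partial sum long enough for it to have stabilized. *)
pose F : fps nat int := FPS (fun m => fcoef (partial_sum x_ 0 (mdeg m).+1) m).
have cF m d : (mdeg m < d)%N -> fcoef (convergent 0 d) m = fcoef F m.
  move=> md; have [g E] := partial_sum_convergent 0 md.
  by rewrite -(fcoef_eqmod x1 (ltnSn _) E).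
exists F; split=> m; exists (mdeg m).+1 => d md; last exact: cF.
rewrite -(cF m d md) //.
(* Taking the depth equal to the number of terms gives agreement modulo [x_ 1 ^+ d], with [d] above
   the degree of [m]. *)
have [g E] := partial_sum_convergent 0 (leqnn d).
rewrite -(fcoef_eqmod x1 md E) /partial_sum big_mkord; congr fcoef.
apply: eq_bigr => n _; rewrite /words_sum -sum_avoids132 mulr_sumr.
by apply: eq_bigr => s _; rewrite weight_perm_word.
Qed.
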